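(* Let $\lambda>0$, $s>1$ and $\theta\in(0,1)$, and let $M^{(s)}_N$ ($N\in\mathbb{N}$) and $M^{(s)}_\infty$ be the discovered-mass processes defined in the context on a common probability space (coupled through the same exponential variables). Let $\tau^{(s)}_{N,\theta}=\inf\{t\ge0:M^{(s)}_N(t)>\theta\}$ and define the limiting hitting time \[ \sigma^{(s)}_{\infty,\theta}:=\inf\{t\ge0:M^{(s)}_\infty(t)\ge\theta\}. \] Then \[ \tau^{(s)}_{N,\theta}\longrightarrow\sigma^{(s)}_{\infty,\theta}\quad\text{almost surely as }N\to\infty. \]
   Context: Let $(E_i)_{i\in\mathbb{N}}$ be i.i.d. $\mathrm{Exp}(1)$ random variables. Put $H^{(s)}_N=\sum_{j=1}^N j^{-s}$, $\zeta(s)=\sum_{n=1}^\infty n^{-s}$, $q^{(s)}_{i,N}=\frac{i^{-s}}{H^{(s)}_N}\mathbf{1}_{\{i\le N\}}$ and $q^{(s)}_i=\frac{i^{-s}}{\zeta(s)}$ for $i\ge1$. Define \[ M^{(s)}_N(t)=\sum_{i=1}^\infty q^{(s)}_{i,N}\mathbf{1}_{\{E_i\le\lambda q^{(s)}_{i,N}t\}},\qquad M^{(s)}_\infty(t)=\sum_{i=1}^\infty q^{(s)}_i\mathbf{1}_{\{E_i\le\lambda q^{(s)}_it\}}. \] (In the sum for $M_N^{(s)}$ the terms with $i>N$ are zero.) Note the strict inequality in the definition of $\tau^{(s)}_{N,\theta}$ and the non-strict one in that of $\sigma^{(s)}_{\infty,\theta}$. *)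

(* Defs.v *)
From HB Require Import structures.
From mathcomp Require Import all_boot all_order all_algebra finmap.
From mathcomp Require Import all_classical all_reals all_analysis.
Import Order.TTheory GRing.Theory Num.Theory.
Import numFieldTopology.Exports numFieldNormedType.Exports.

Set Implicit Arguments.
Unset Strict Implicit.
Unset Printing Implicit Defensive.

Local Open Scope classical_set_scope.
Local Open Scope ring_scope.

(* Mutual independence of the subfamily (X i) indexed by i \in D. *)
Definition mutually_independent d d' (T : measurableType d)
    (T' : measurableType d') (R : realType) (P : probability T R)
    (I : choiceType) (D : set I) (X : I -> {RV P >-> T'}) : Prop :=
  forall (F : {fset I}) (A : I -> set T'),
    [set` F] `<=` D ->
    (forall i, i \in F -> measurable (A i)) ->
    P (\bigcap_(i in [set` F]) (X i @^-1` A i)) =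
    (\prod_(i <- F) P (X i @^-1` A i))%E.

(* The law is only prescribed on measurable sets: on other sets the values of
   a measure are junk. *)
Definition has_exponential_law d (T : measurableType d) (R : realType)
    (P : probability T R) (rate : R) (X : {RV P >-> R}) : Prop :=
  forall A : set R, measurable A ->
    distribution P X A = exponential_prob rate A.

(* E 0 is unconstrained: the family is indexed from 1. *)
Definition iid_exponential d (T : measurableType d) (R : realType)
    (P : probability T R) (rate : R) (E : nat -> {RV P >-> R}) : Prop :=
  mutually_independent [set i | (0 < i)%N] E /\
  forall i, (0 < i)%N -> has_exponential_law rate (E i).

Section discovered_mass.
Context {R : realType}.
Implicit Types (lambda s theta t : R) (N i : nat).

Definition gen_harmonic s N : R := \sum_(1 <= j < N.+1) j%:R `^ (- s).

(* The sum of the series \sum_(n >= 1) n^(-s), meaningful for s > 1. *)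
Definition zeta s : R := limn (gen_harmonic s).

Definition zipf s N i : R :=
  i%:R `^ (- s) / gen_harmonic s N * (i <= N)%N%:R.

Definition zipf_lim s i : R := i%:R `^ (- s) / zeta s.

(* x is a realization of the sequence of exponential variables.  The series is
   taken in \bar R; its terms are nonnegative as soon as q is. *)
Definition discovered_mass lambda (q : nat -> R) (x : nat -> R) t : \bar R :=
  (\sum_(1 <= i <oo) (q i * (x i <= lambda * q i * t)%R%:R)%:E)%E.

Definition M_fin lambda s N (x : nat -> R) t : \bar R :=
  discovered_mass lambda (zipf s N) x t.

Definition M_lim lambda s (x : nat -> R) t : \bar R :=
  discovered_mass lambda (zipf_lim s) x t.

(* Infima are taken in \bar R, so that a level that is never reached has
   hitting time +oo. *)
Definition tau lambda s theta N (x : nat -> R) : \bar R :=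
  ereal_inf [set t%:E | t in
    [set t : R | 0 <= t /\ (theta%:E < M_fin lambda s N x t)%E]].

Definition sigma_lim lambda s theta (x : nat -> R) : \bar R :=
  ereal_inf [set t%:E | t in
    [set t : R | 0 <= t /\ (theta%:E <= M_lim lambda s x t)%E]].

End discovered_mass.

(* Main.v *)
(* Undoing the normalisation by a change of time, M_N(H_N t / zeta) equals
   zeta / H_N times the sum of the first N terms of M_oo(t).  By the first
   Borel-Cantelli lemma, almost surely only finitely many coordinates are
   discovered by any given time, so if M_oo(t) >= theta then for large N this
   partial sum is M_oo(t), and H_N < zeta gives M_N(H_N t / zeta) > theta, whence
   tau_N <= t.  Conversely M_oo(t) < theta forces M_N(H_N t / zeta) <= theta
   eventually, so tau_N >= H_N t / zeta, which tends to t. *)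
Require Import Defs.
From HB Require Import structures.
From mathcomp Require Import all_boot all_order all_algebra finmap.
From mathcomp Require Import all_classical all_reals all_analysis.
From mathcomp Require Import ring lra.
Import Order.TTheory GRing.Theory Num.Theory.
Import numFieldTopology.Exports numFieldNormedType.Exports.

Set Implicit Arguments.
Unset Strict Implicit.
Unset Printing Implicit Defensive.

Local Open Scope classical_set_scope.
Local Open Scope ring_scope.

(** * Partial sums of the zeta series: an explicit bound and convergence *)

Section harmonic.
Context {R : realType}.
Implicit Types s : R.

Lemma gen_harmonic0 s : gen_harmonic s 0 = 0.
Proof. by rewrite /gen_harmonic big_geq. Qed.

Lemma gen_harmonicS s N :
  gen_harmonic s N.+1 = gen_harmonic s N + N.+1%:R `^ (- s).
Proof. by rewrite /gen_harmonic big_nat_recr. Qed.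

Lemma gen_harmonic_ltS s N : gen_harmonic s N < gen_harmonic s N.+1.
Proof. by rewrite gen_harmonicS ltrDl powR_gt0. Qed.

Lemma gen_harmonic_ndecr s : nondecreasing_seq (gen_harmonic s).
Proof. by apply/nondecreasing_seqP => N; rewrite ltW// gen_harmonic_ltS. Qed.

Lemma gen_harmonic_gt0 s N : (0 < N)%N -> 0 < gen_harmonic s N.
Proof.
move=> N0; apply: lt_le_trans (gen_harmonic_ndecr s N0).
by rewrite gen_harmonicS gen_harmonic0 powR1 add0r.
Qed.

(* The discrete form of [x^(-s) = - (x^(1 - s) / (s - 1))']. *)
Lemma powRN_le_telescope s n : 1 < s ->
  n.+2%:R `^ (- s) <=
    (n.+1%:R `^ (1 - s) - n.+2%:R `^ (1 - s)) / (s - 1).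
Proof.
move=> s1; have a0 : 0 < s - 1 by rewrite subr_gt0.
have m0 : (0 : R) < n.+2%:R by [].
rewrite ler_pdivlMr//.
have -> : (n.+2%:R : R) `^ (- s) = n.+2%:R `^ (1 - s) / n.+2%:R.
  rewrite -[X in _ = _ / X]powRr1; last exact: ltW.
  by rewrite -powRB ?pnatr_eq0 ?implybT//; congr powR; ring.
(* Two tangent-line bounds do the work: ln (1 + y) <= y at y = -1/(n+2) here, then 1 + y <= exp y at
   y = (1 - s) ln ((n+1)/(n+2)), once the factor (n+2)^(1-s) is cancelled. *)
have lnle : ln (n.+1%:R / n.+2%:R) <= - n.+2%:R^-1 :> R.
  have -> : n.+1%:R / n.+2%:R = 1 + (- n.+2%:R^-1) :> R.
    by rewrite -[n.+1%:R](addrK 1) natr1 mulrBl mulfV ?pnatr_eq0// mul1r.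
  by apply: le_ln1Dx; rewrite ltrN2 invf_lt1// ltr1n.
have -> : (n.+1%:R : R) `^ (1 - s) =
    n.+2%:R `^ (1 - s) * expR ((1 - s) * ln (n.+1%:R / n.+2%:R)).
  rewrite ln_div ?posrE// /powR !pnatr_eq0/= -expRD; congr expR; ring.
rewrite -mulrA -[X in _ <= _ - X]mulr1 -mulrBr ler_pM2l ?powR_gt0//.
rewrite lerBrDl; apply: le_trans (expR_ge1Dx _); rewrite lerD2l.
rewrite mulrC -[leLHS]mulrNN opprB ler_nM2l// subr_lt0//.
Qed.

Lemma gen_harmonic_le s N : 1 < s -> gen_harmonic s N <= 1 + (s - 1)^-1.
Proof.
move=> s1; have a0 : 0 < (s - 1)^-1 by rewrite invr_gt0 subr_gt0.
(* The index moves to [N.+1] because the telescoping bound only covers the terms from 2^(-s) on; the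
   first term gives the constant 1. Keeping the subtracted remainder below lets the induction
   telescope. *)
apply: (le_trans (gen_harmonic_ndecr s (leqnSn N))).
suff : gen_harmonic s N.+1 <= 1 + (s - 1)^-1 - N.+1%:R `^ (1 - s) / (s - 1).
  move=> /le_trans; apply; rewrite gerBl mulr_ge0 ?powR_ge0//; exact: ltW.
elim: N => [|N IH].
  by rewrite gen_harmonicS gen_harmonic0 !powR1 add0r mul1r addrK.
have := lerD IH (powRN_le_telescope N s1).
by rewrite (gen_harmonicS s N.+1) => /le_trans; apply; rewrite mulrBl addrA subrK.
Qed.

Lemma is_cvg_gen_harmonic s : 1 < s -> cvgn (gen_harmonic s).
Proof.
move=> s1; apply: nondecreasing_is_cvgn; first exact: gen_harmonic_ndecr.
by exists (1 + (s - 1)^-1) => _ [N _ <-]; exact: gen_harmonic_le.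
Qed.

Lemma gen_harmonic_lt_zeta s N : 1 < s -> gen_harmonic s N < zeta s.
Proof.
move=> s1; apply: lt_le_trans (gen_harmonic_ltS s N) _.
exact: nondecreasing_cvgn_le (@gen_harmonic_ndecr s) (is_cvg_gen_harmonic s1) _.
Qed.

Lemma zeta_gt0 s : 1 < s -> 0 < zeta s.
Proof. by move=> /(gen_harmonic_lt_zeta 0); rewrite gen_harmonic0. Qed.

Lemma cvg_gen_harmonic_ratio s : 1 < s ->
  gen_harmonic s N / zeta s @[N --> \oo] --> (1 : R).
Proof.
move=> s1; rewrite -[X in _ --> X](@mulfV _ (zeta s)) ?gt_eqF ?zeta_gt0//.
by apply: cvgMr_tmp; exact: is_cvg_gen_harmonic.
Qed.

End harmonic.

(** * Borel-Cantelli for exponential variables *)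

Section borel_cantelli_exponential.
Context (R : realType) (d : measure_display) (T : measurableType d)
  (P : probability T R).

(** The density vanishes on the negative half-line, and the mass 1 - exp (-c) of [0, c] is at most
    c. *)
Lemma exponential_cdf_le (X : {RV P >-> R}) (c : R) :
  has_exponential_law 1 X -> 0 < c -> (P (X @^-1` `]-oo, c]) <= c%:E)%E.
Proof.
move=> hX c0.
have -> : X @^-1` `]-oo, c] = X @^-1` `]-oo, 0[ `|` X @^-1` `[0, c].
  rewrite -preimage_setU; congr (_ @^-1` _).
  apply/seteqP; split => x /=; rewrite !in_itv/=; first by case: ltP; auto.
  by move=> [x0|/andP[//]]; rewrite ltW// (lt_trans x0).
apply: le_trans (measureU2 _ _ _) _; try exact: measurable_funPTI.
rewrite -[leRHS]add0e; apply: leeD.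
  rewrite [leLHS](hX _ (measurable_itv _)) [leLHS]integral0_eq// => x /=.
  by rewrite in_itv/= => x0; rewrite lt0_exponential_pdf.
rewrite [leLHS](hX _ (measurable_itv _)).
rewrite exponential_prob_itv0c// -EFinB lee_fin.
by have := expR_ge1Dx (-1 * c); lra.
Qed.

Lemma ae_eventually_gt (E : nat -> {RV P >-> R}) (c : nat -> R) (B : R) :
  (forall i, (0 < i)%N -> has_exponential_law 1 (E i)) ->
  (forall i, (0 < i)%N -> 0 < c i) ->
  (forall N, \sum_(1 <= i < N.+1) c i <= B) ->
  {ae P, forall w, \forall i \near \oo, c i < E i w}.
Proof.
move=> hE c0 cB.
pose F n := E n.+1 @^-1` `]-oo, c n.+1].
have mF n : measurable (F n) by exact: measurable_funPTI.
have F0 : P (lim_sup_set F) = 0%E.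
  apply: lim_sup_set_cvg0 => //; apply: (@le_lt_trans _ _ B%:E); last exact: ltry.
  apply: lime_le; first exact: is_cvg_nneseries.
  apply: nearW => N; apply: (@le_trans _ _ (\sum_(0 <= i < N) c i.+1)%:E).
    rewrite -sumEFin; apply: lee_sum => i _.
    by apply: exponential_cdf_le; [exact: hE|exact: c0].
  by have := cB N; rewrite big_add1 lee_fin.
exists (lim_sup_set F); split => //.
  by apply: bigcap_measurable => // k _; apply: bigcup_measurable => j _.
(* If [w] lies in no [F i] with i >= k, the inequality holds from index [k.+1] on, the shift coming
   from the definition of [F]. *)
move=> w /= hw k _; apply: contrapT => hk; apply: hw.
exists k.+1 => // -[//|i] /= ki; rewrite ltNge; apply/negP => Ec; apply: hk.
by exists i => //=; rewrite /F /= in_itv.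
Qed.

End borel_cantelli_exponential.

(** Open intervals, bounded or not, form a neighbourhood base of the order topology, so finite and
    infinite limits fall under the same two one-sided conditions. *)
Lemma cvg_order {R : realType} (u : nat -> \bar R) (l : \bar R) :
  (forall a, (a < l)%E -> \forall n \near \oo, (a < u n)%E) ->
  (forall b, (l < b)%E -> \forall n \near \oo, (u n < b)%E) ->
  u @ \oo --> l.
Proof.
move=> lo up A; rewrite itv_nbhsE => -[i [oi li] iA].
suff : \forall n \near \oo, u n \in i by apply: filterS => n /iA.
move: i oi li {iA} => [[[] a|[]] [[] b|[]]] // oi; rewrite in_itv/=.
- move=> /andP[al lb]; near=> n; rewrite in_itv/=; apply/andP.
  by split; near: n; [exact: lo|exact: up].
- by rewrite andbT => /lo; apply: filterS => n; rewrite in_itv/= andbT.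
- by move=> /up; apply: filterS => n; rewrite in_itv.
- by move=> _; apply: nearW => n; rewrite in_itv.
Unshelve. all: by end_near. Qed.

(** * Hitting times along a fixed realization *)

Section hitting_times.
Context {R : realType} (lambda s theta : R) (x : nat -> R).
Hypotheses (lambda_gt0 : 0 < lambda) (s_gt1 : 1 < s) (theta_gt0 : 0 < theta).

Local Notation H := (gen_harmonic s).
Local Notation zt := (zeta s).
Local Notation tauN := (fun N => tau lambda s theta N x).
Local Notation sigma := (sigma_lim lambda s theta x).

Let mass_lim t i : R := zipf_lim s i * (x i <= lambda * zipf_lim s i * t)%R%:R.

Let mass_lim_ge0 t i : 0 <= mass_lim t i.
Proof. by rewrite mulr_ge0// divr_ge0 ?powR_ge0// ltW// zeta_gt0. Qed.

(** At time [H N / zt * t] the discovery thresholds of the first N coordinates are those of the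
    limit process at time t; only the weights differ, by the factor [zt / H N]. *)
Let M_fin_rescaled N t : (0 < N)%N ->
  M_fin lambda s N x (H N / zt * t) =
    (zt / H N * \sum_(1 <= i < N.+1) mass_lim t i)%:E.
Proof.
move=> N0; have HN := gen_harmonic_gt0 s N0; have z0 := zeta_gt0 s_gt1.
rewrite /M_fin /discovered_mass (nneseries_split _ N); last first.
  move=> i _; rewrite lee_fin mulr_ge0// mulr_ge0// divr_ge0 ?powR_ge0//.
  exact: ltW.
rewrite [X in (_ + X)%E]eseries0 ?adde0; last first.
  by move=> i; rewrite add1n => Ni _; rewrite /zipf leqNgt Ni mulr0 mul0r.
rewrite add1n sumEFin; congr EFin; rewrite mulr_sumr.
apply: eq_big_nat => i /andP[_]; rewrite ltnS /mass_lim /zipf /zipf_lim => ->.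
rewrite mulr1.
have -> : lambda * (i%:R `^ (- s) / H N) * (H N / zt * t) =
    lambda * (i%:R `^ (- s) / zt) * t by field; rewrite !gt_eqF.
rewrite [RHS]mulrA; congr *%R; field; rewrite !gt_eqF//.
Qed.

Let M_fin_ndecr N t t' : (0 < N)%N -> t <= t' ->
  (M_fin lambda s N x t <= M_fin lambda s N x t')%E.
Proof.
move=> N0 tt'.
have q0 i : 0 <= zipf s N i.
  by rewrite mulr_ge0// divr_ge0 ?powR_ge0// ltW// gen_harmonic_gt0.
apply: lee_nneseries => i _; first by rewrite lee_fin mulr_ge0.
rewrite lee_fin ler_wpM2l// ler_nat.
case: leP => // xi; rewrite (le_trans xi)// ler_wpM2l// mulr_ge0//; exact: ltW.
Qed.

Let tau_le N t : 0 <= t -> (theta%:E < M_fin lambda s N x t)%E ->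
  (tauN N <= t%:E)%E.
Proof. by move=> t0 Mt; apply: ereal_inf_lbound; exists t. Qed.

(** By monotonicity in time, no time before t can have mass above [theta]. *)
Let tau_ge N t : (0 < N)%N -> (M_fin lambda s N x t <= theta%:E)%E ->
  (t%:E <= tauN N)%E.
Proof.
move=> N0 Mt; apply: le_ereal_inf_tmp => _ [t' [_ Mt'] <-]; rewrite lee_fin leNgt.
apply/negP => /ltW t't; have := lt_le_trans Mt' (M_fin_ndecr N0 t't).
by rewrite ltNge Mt.
Qed.

Let tau_ge0 N : (0 <= tauN N)%E.
Proof. by apply: le_ereal_inf_tmp => _ [t [t0 _] <-]; rewrite lee_fin. Qed.

(** The pathwise form of the almost sure event: with u = t / zeta, all but finitely many coordinates
    are still undiscovered at time t in the limit process. *)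
Hypothesis x_large : forall u,
  \forall i \near \oo, lambda * i%:R `^ (- s) * u < x i.

Let tau_eventually_le t : 0 <= t -> (theta%:E <= M_lim lambda s x t)%E ->
  \forall N \near \oo, (tauN N <= t%:E)%E.
Proof.
move=> t0 Mt; have z0 := zeta_gt0 s_gt1.
have [n0 _ xn0] := x_large (t / zt).
near=> N.
have N0 : (0 < N)%N by near: N; exact: nbhs_infty_gt.
have n0N : (n0 <= N)%N by near: N; exact: nbhs_infty_ge.
have HN := gen_harmonic_gt0 s N0.
have Hz := gen_harmonic_lt_zeta N s_gt1.
have {Mt} MS : theta <= \sum_(1 <= i < N.+1) mass_lim t i.
  move: Mt; rewrite /M_lim /discovered_mass (nneseries_split _ N); last first.
    by move=> i _; rewrite lee_fin mass_lim_ge0.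
  rewrite [X in (_ + X)%E]eseries0 ?adde0 ?add1n ?sumEFin ?lee_fin// => i.
  move=> Ni _; rewrite leNgt.
  have /= := xn0 i (leq_trans n0N (ltnW Ni)).
  have -> : lambda * i%:R `^ (- s) * (t / zt) = lambda * zipf_lim s i * t.
    by rewrite /zipf_lim; ring.
  by move=> ->; rewrite mulr0.
(* Strictness comes from [zt / H N] > 1 and [theta] > 0, even when the limit mass equals [theta]. *)
have Mth : (theta%:E < M_fin lambda s N x (H N / zt * t))%E.
  rewrite M_fin_rescaled// lte_fin.
  apply: lt_le_trans (ler_wpM2l _ MS); last by rewrite divr_ge0// ltW.
  by rewrite ltr_pMl// ltr_pdivlMr// mul1r.
apply: (@le_trans _ _ (H N / zt * t)%:E).
  by apply: tau_le => //; rewrite mulr_ge0// divr_ge0// ltW.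
by rewrite lee_fin ler_piMl// ler_pdivrMr// mul1r ltW.
Unshelve. all: by end_near. Qed.

Let tau_eventually_ge t : 0 <= t -> (M_lim lambda s x t < theta%:E)%E ->
  \forall N \near \oo, ((H N / zt * t)%:E <= tauN N)%E.
Proof.
move=> t0 Mt; have z0 := zeta_gt0 s_gt1.
have Mfin : M_lim lambda s x t \is a fin_num.
  rewrite ge0_fin_numE ?(lt_trans Mt) ?ltry//.
  by apply: nneseries_ge0 => i _ _; rewrite lee_fin mass_lim_ge0.
move: Mt; rewrite -(fineK Mfin) lte_fin; set m := fine _ => Mt.
(* The gap m < [theta] absorbs the weight factor: once [H N / zt] exceeds m / theta, the product of
   [zt / H N] and m is below [theta]. *)
have Hm : m / theta < 1 by rewrite ltr_pdivrMr// mul1r.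
near=> N.
have N0 : (0 < N)%N by near: N; exact: nbhs_infty_gt.
have HN := gen_harmonic_gt0 s N0.
have mH : m / theta < H N / zt.
  by near: N; apply: (cvgr_gt _ (cvg_gen_harmonic_ratio s_gt1)).
apply: tau_ge => //; rewrite M_fin_rescaled// lee_fin.
have Sm : \sum_(1 <= i < N.+1) mass_lim t i <= m.
  rewrite -lee_fin -sumEFin fineK//; apply: nneseries_lim_ge => i _ _.
  by rewrite lee_fin mass_lim_ge0.
apply: le_trans (ler_wpM2l _ Sm) _; first by rewrite divr_ge0// ltW.
rewrite mulrAC ler_pdivrMr// -ler_pdivlMl//.
move: mH; rewrite ltr_pdivrMr// mulrAC ltr_pdivlMr// => /ltW.
by rewrite mulrC ler_pdivlMl// mulrC [theta * _]mulrC.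
Unshelve. all: by end_near. Qed.

Lemma cvg_tau : tauN @ \oo --> sigma.
Proof.
apply: cvg_order => [a asigma|b /ereal_inf_lt[_ [t [t0 Mt] <-] tb]]; last first.
  by apply: filterS (tau_eventually_le t0 Mt) => N /le_lt_trans; apply.
have [a0|a0] := ltP a 0%E.
  by apply: nearW => N; exact: lt_le_trans a0 (tau_ge0 N).
(* The room between a and r compensates the factor [H N / zt], which is below 1 but eventually above
   a / r. If [sigma] is infinite, r is a + 1. *)
have [r] : exists r, (a < r%:E < sigma)%E.
  move: a a0 asigma => [a||]//= _; case: sigma => [v||]//.
    by rewrite lte_fin => av; exists ((a + v) / 2); rewrite !lte_fin !midf_lt.
  by move=> _; exists (a + 1); rewrite lte_fin ltrDl ltr01 ltry.
move=> /andP[ar rsigma].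
have r0 : 0 < r by rewrite -lte_fin (le_lt_trans a0).
have Mr : (M_lim lambda s x r < theta%:E)%E.
  rewrite ltNge; apply/negP => Mr; move: rsigma; rewrite ltNge => /negP; apply.
  by apply: ereal_inf_lbound; exists r => //; split => //; exact: ltW.
have afin : a \is a fin_num by rewrite ge0_fin_numE// (lt_trans ar) ?ltry.
near=> N.
apply: (@lt_le_trans _ _ (H N / zeta s * r)%:E); last first.
  by near: N; exact: tau_eventually_ge (ltW r0) Mr.
rewrite -(fineK afin) lte_fin -ltr_pdivrMr//.
near: N; apply: (cvgr_gt _ (cvg_gen_harmonic_ratio s_gt1)).
by rewrite ltr_pdivrMr// mul1r -lte_fin fineK.
Unshelve. all: by end_near. Qed.

End hitting_times.

(** * From the pathwise limit to almost sure convergence *)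

Unset Implicit Arguments.

Theorem theorem7p4 (R : realType) (d : measure_display) (T : measurableType d)
    (P : probability T R) (E : nat -> {RV P >-> R})
    (lambda s theta : R)
    (hE : iid_exponential 1 E)
    (hlambda : 0 < lambda) (hs : 1 < s) (htheta0 : 0 < theta)
    (htheta1 : theta < 1) :
  {ae P, forall w : T,
    (fun N : nat => tau lambda s theta N (fun i => E i w)) @ \oo -->
    sigma_lim lambda s theta (fun i => E i w)}.
Proof.
(* Integer values of u keep the exceptional null sets countable in number; a real u is then
   dominated by [(Num.truncn u).+1]. *)
have large (k : nat) : {ae P, forall w,
    \forall i \near \oo, lambda * i%:R `^ (- s) * k.+1%:R < E i w}.
  apply: (@ae_eventually_gt _ _ _ _ _ _ (lambda * k.+1%:R * (1 + (s - 1)^-1))).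
  - by case: hE.
  - by move=> i i0; rewrite !mulr_gt0// powR_gt0// ltr0n.
  - move=> N; under eq_bigr do rewrite mulrAC.
    rewrite -mulr_sumr ler_wpM2l//; first by rewrite mulr_ge0// ltW.
    exact: gen_harmonic_le.
apply: filterS (ae_foralln large) => w xlarge; apply: cvg_tau => // u.
apply: filterS (xlarge (Num.truncn u)) => i; apply: le_lt_trans.
rewrite ler_wpM2l//; first by rewrite mulr_ge0 ?powR_ge0// ltW.
exact/ltW/truncnS_gt.
Qed.
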